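(* Let $n\geq 3$. Suppose that $\{\sigma_\lambda:\lambda\in\Lambda\}$ is a quantum deformation of the Schubert basis $\{\tau_\lambda:\lambda\in\Lambda\}$ of $\mathrm{QH}^*(\mathrm{IG}(2,2n+1))$ such that, for every $\mu\in\Lambda$, the coefficients of the expansion of $\sigma_{(1,1)}\star\sigma_\mu$ in the basis $\{\sigma_\lambda:\lambda\in\Lambda\}$ are polynomials in $q$ with non-negative coefficients. Then $\tau_\lambda=\sigma_\lambda$ for all $\lambda\in\Lambda$.
   Context: Let $\mathrm{IG}:=\mathrm{IG}(2,2n+1)$ be the odd symplectic Grassmannian of lines, i.e. the variety of two-dimensional subspaces of $\mathbb{C}^{2n+1}$ that are isotropic for a general skew-symmetric form; $\dim \mathrm{IG}=4n-3$. Its quantum cohomology ring $(\mathrm{QH}^*(\mathrm{IG}),\star)$ is a commutative, associative, unital graded $\mathbb{Z}[q]$-algebra with $\deg q=2n$ (work with $\mathbb{Q}$-coefficients when rational constants appear). It is free over $\mathbb{Z}[q]$ on the Schubert basis $\{\tau_\lambda:\lambda\in\Lambda\}$, where $$\Lambda=\{(\lambda_1,\lambda_2)\in\mathbb{Z}^2: 2n-1\ge\lambda_1\ge\lambda_2\ge-1,\ \lambda_1>n-2\Rightarrow\lambda_1>\lambda_2,\ \text{and } \lambda_2=-1\Rightarrow\lambda_1=2n-1\}.$$ Here $|\lambda|=\lambda_1+\lambda_2$, $\deg\tau_\lambda=|\lambda|$, $\tau_{(0,0)}=1$, $\tau_i$ means $\tau_{(i,0)}$, and $\tau_{(a,b)}$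 is read as $0$ if $(a,b)\notin\Lambda$. The multiplication is governed by the known quantum Pieri rule (Pech): for $(a,b)\in\Lambda$, $\tau_1\star\tau_{(a,b)}$ equals $\tau_{(a+1,b)}+\tau_{(a,b+1)}$ if $a+b\ne 2n-3$ and $a\ne 2n-1$; $\tau_{(a,b+1)}+2\tau_{(a+1,b)}+\tau_{(a+2,b-1)}$ if $a+b=2n-3$; $\tau_{(2n-1,b+1)}+q\tau_{(b,0)}$ if $a=2n-1$, $0\le b\le 2n-3$; $\tau_{(2n-1,0)}$ if $a=2n-1$, $b=-1$; $q(\tau_{(2n-1,-1)}+\tau_{(2n-2,0)})$ if $a=2n-1$, $b=2n-2$; and $\tau_{(1,1)}\star\tau_{(a,b)}$ equals $\tau_{(a+1,b+1)}$ if $a+b\ne 2n-4,2n-3$ and $a\ne 2n-1$; $\tau_{(a+2,b)}+\tau_{(a+1,b+1)}$ if $a+b=2n-4$ or $2n-3$; $q\tau_{(b+1,0)}$ if $a=2n-1$, $b\ne 2n-3$; $q(\tau_{(2n-1,-1)}+\tau_{(2n-2,0)})$ if $a=2n-1$, $b=2n-3$. Quantum deformation: given constants $a_{\lambda,\mu}\in\mathbb{Q}$ ($\lambda,\mu\in\Lambda$), the corresponding quantum deformation is the family $\{\sigma_\lambda:\lambda\in\Lambda\}$ solving the system $\tau_\lambda=\sigma_\lambda+\sum_{j\ge1}\ \sum_{\mu\in\Lambda,\ |\mu|+2nj=|\lambda|}a_{\lambda,\mu}\,q^j\sigma_\mu$ for all $\lambda\in\Lambda$. It is a homogeneous $\mathbb{Q}[q]$-basis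 of $\mathrm{QH}^*(\mathrm{IG})\otimes\mathbb{Q}$. *)

(* Defs.v *)
From HB Require Import structures.
From mathcomp Require Import all_boot all_order all_algebra.
From mathcomp Require Import zify.

Set Implicit Arguments.
Unset Strict Implicit.
Unset Printing Implicit Defensive.

Import Order.TTheory GRing.Theory Num.Theory.
Local Open Scope ring_scope.

Definition inLambda (n : nat) (l : int * int) : bool :=
  [&& l.1 <= 2 * n%:Z - 1, l.2 <= l.1, -1 <= l.2,
      (n%:Z - 2 < l.1) ==> (l.2 < l.1)
    & (l.2 == -1) ==> (l.1 == 2 * n%:Z - 1)].

Record Lambda (n : nat) : Type :=
  MkLambda { part :> int * int; partP : inLambda n part }.

HB.instance Definition _ (n : nat) := [isSub for @part n].
HB.instance Definition _ (n : nat) := [Countable of Lambda n by <:].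

Definition Lambda_grid (n : nat) : seq (int * int) :=
  [seq (i%:Z - 1, j%:Z - 1) | i <- iota 0 (2 * n).+1, j <- iota 0 (2 * n).+1].

Lemma Lambda_gridP (n : nat) (p : int * int) :
  inLambda n p -> p \in Lambda_grid n.
Proof.
case: p => a b /and5P[/= h1 h2 h3 _ _].
apply/allpairsP; exists (absz (a + 1), absz (b + 1)).
by rewrite !mem_iota /=; split; [lia | lia | congr pair; lia].
Qed.

Definition Lambda_enum (n : nat) : seq (Lambda n) :=
  undup (pmap insub (Lambda_grid n)).

Lemma Lambda_enumP (n : nat) : Finite.axiom (Lambda_enum n).
Proof.
apply: Finite.uniq_enumP; first exact: undup_uniq.
move=> l; rewrite mem_undup mem_pmap_sub [RHS]inE.
exact: Lambda_gridP (partP l).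
Qed.

HB.instance Definition _ (n : nat) :=
  isFinite.Build (Lambda n) (@Lambda_enumP n).

Definition wt (n : nat) (l : Lambda n) : int := l.1 + l.2.

(* [at_ f (a, b)] reads f_(a,b) as 0 when (a, b) is not in Lambda. *)
Definition at_ (n : nat) (V : nmodType) (f : Lambda n -> V) (p : int * int) : V :=
  oapp f 0 (insub p).

Section QuantumCohomology.

Variables (n : nat) (A : comAlgType {poly rat}).

(* The quantum parameter q is 'X : {poly rat}. *)

Definition is_basis (f : Lambda n -> A) : Prop :=
  forall x : A, exists! c : {ffun Lambda n -> {poly rat}},
    x = \sum_(l : Lambda n) c l *: f l.

Section Ring.

Variable tau : Lambda n -> A.

Local Notation N := (2 * n%:Z).
Local Notation T := (at_ tau).

(* [A] with its Schubert basis [tau] is QH^*(IG(2,2n+1)), with rational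
   coefficients.  [QH_graded] says that the Z[q]-span of [tau] is a
   subring, graded by deg tau_l = |l| and deg q = 2n.  Since tau_1 and
   tau_(1,1) generate the ring, the Pieri rule determines (A, tau) up to a
   unique isomorphism. *)
Record is_QH_IG : Prop := IsQHIG {
  QH_basis : is_basis tau;
  QH_one : T (0, 0) = 1;
  QH_graded : forall l m : Lambda n, exists c : Lambda n -> {poly int},
    tau l * tau m = \sum_(k : Lambda n) map_poly intr (c k) *: tau k /\
    (forall (k : Lambda n) (d : nat), (c k)`_d != 0 ->
       wt k + N * d%:Z = wt l + wt m);
  QH_pieri1_generic : forall a b : int, inLambda n (a, b) ->
    a + b != N - 3 -> a != N - 1 ->
    T (1, 0) * T (a, b) = T (a + 1, b) + T (a, b + 1);
  QH_pieri1_middle : forall a b : int, inLambda n (a, b) ->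
    a + b = N - 3 ->
    T (1, 0) * T (a, b) = T (a, b + 1) + T (a + 1, b) *+ 2 + T (a + 2, b - 1);
  QH_pieri1_quantum : forall b : int, inLambda n (N - 1, b) ->
    0 <= b <= N - 3 ->
    T (1, 0) * T (N - 1, b) = T (N - 1, b + 1) + 'X *: T (b, 0);
  QH_pieri1_neg : T (1, 0) * T (N - 1, -1) = T (N - 1, 0);
  QH_pieri1_point :
    T (1, 0) * T (N - 1, N - 2) = 'X *: (T (N - 1, -1) + T (N - 2, 0));
  QH_pieri11_generic : forall a b : int, inLambda n (a, b) ->
    a + b != N - 4 -> a + b != N - 3 -> a != N - 1 ->
    T (1, 1) * T (a, b) = T (a + 1, b + 1);
  QH_pieri11_middle : forall a b : int, inLambda n (a, b) ->
    a + b = N - 4 \/ a + b = N - 3 ->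
    T (1, 1) * T (a, b) = T (a + 2, b) + T (a + 1, b + 1);
  QH_pieri11_quantum : forall b : int, inLambda n (N - 1, b) ->
    b != N - 3 ->
    T (1, 1) * T (N - 1, b) = 'X *: T (b + 1, 0);
  QH_pieri11_line :
    T (1, 1) * T (N - 1, N - 3) = 'X *: (T (N - 1, -1) + T (N - 2, 0))
}.

End Ring.

(* Since |m| >= 0, the condition |m| + 2nj = |l| forces j <= |l| for n > 0,
   so the sum over all j >= 1 may be truncated there. *)
Definition quantum_deformation (tau : Lambda n -> A)
    (a : Lambda n -> Lambda n -> rat) (sigma : Lambda n -> A) : Prop :=
  forall l : Lambda n,
    tau l = sigma l +
      \sum_(1 <= j < (absz (wt l)).+1)
        \sum_(m : Lambda n | wt m + 2 * n%:Z * j%:Z == wt l)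
          ((a l m)%:P * 'X^j) *: sigma m.

Definition nonneg_expansion (f : Lambda n -> A) (x : A) : Prop :=
  exists c : Lambda n -> {poly rat},
    x = \sum_(l : Lambda n) c l *: f l /\
    (forall (l : Lambda n) (d : nat), 0 <= (c l)`_d).

End QuantumCohomology.

(* Main.v *)
Require Import Defs.
From HB Require Import structures.
From mathcomp Require Import all_boot all_order all_algebra.
From mathcomp Require Import zify ring.

Set Implicit Arguments.
Unset Strict Implicit.
Unset Printing Implicit Defensive.

Import Order.TTheory GRing.Theory Num.Theory.
Local Open Scope ring_scope.

(** The degrees |l| range over [0, 4n-3] and q has degree 2n, so a quantum
deformation involves only the first power of q:
  sigma_l = tau_l - q * \sum_m e(l, m) tau_m,
where e(l, m) is the deformation constant if |m| = |l| - 2n, and 0 otherwise.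
In particular sigma_l = tau_l when |l| < 2n, and sigma_(1,1) = tau_(1,1).
The theorem says that e vanishes.

The coefficient of q sigma_l in tau_(1,1) * sigma_m is
  (coefficient of q sigma_l in tau_(1,1) * tau_m)
    - \sum_k e(m, k) (coefficient of tau_l in tau_(1,1) * tau_k),
and its non-negativity ([deformed_pieri_ge0]) turns, through the Pieri rule,
into inequalities on e.
- Away from the boundary a = 2n-1, multiplication by tau_(1,1) shifts an index
  of degree at least 2n-2 by (1,1), and it shifts the indices k by (1,1) as
  well; hence e(m, k) <= e(m + (1,1), k + (1,1)) ([defect_shift]).  As e
  vanishes in degrees below 2n, induction gives e >= 0 ([defect_ge0]).
- For m = (2n-1, b), the product tau_(1,1) * tau_m is q times at most two
  classes, whose second index is at most 0; all other coefficients give upper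
  bounds by 0.  If b <= 2n-4 the bound is on a single e(m, k).  For the two
  remaining values of b, the classes k lie in the degrees 2n-4 and 2n-3, where
  the Pieri rule has two terms, and the bound is on a sum of two values of e;
  this suffices because e >= 0.  So e(m, k) = 0 on the boundary
  ([defect_boundary]).
- Every index of degree at least 2n reaches the boundary by shifts by (1,1), so
  0 <= e(m, k) <= e(m + (1,1), k + (1,1)) <= ... <= 0 ([defect_eq0]). *)

(** * Families indexed by Lambda, extended by zero *)

Section ExtensionByZero.

Variables (n : nat) (V : nmodType) (f : Lambda n -> V).

Lemma at_part (l : Lambda n) : at_ f (part l) = f l.
Proof. by rewrite /at_ valK. Qed.

Lemma at_notin (p : int * int) : ~~ inLambda n p -> at_ f p = 0.
Proof. by move=> np; rewrite /at_ insubN. Qed.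

End ExtensionByZero.

Lemma sum_at (n : nat) (R : pzSemiRingType) (f : Lambda n -> R) p :
  \sum_(l : Lambda n) f l * (part l == p)%:R = at_ f p.
Proof.
have [pL | npL] := boolP (inLambda n p).
  rewrite (bigD1 (MkLambda pL)) //= eqxx mulr1 big1 ?addr0.
    exact: (esym (at_part f (MkLambda pL))).
  move=> l nl; case: eqP => [lp|_]; last by rewrite mulr0.
  by case/eqP: nl; apply: val_inj.
rewrite at_notin // big1 // => l _; case: eqP => [lp|_]; last by rewrite mulr0.
by move: npL; rewrite -lp partP.
Qed.

Lemma wt_ge0 (n : nat) (l : Lambda n) : (0 < n)%N -> 0 <= wt l.
Proof. by case: l => [[c d] /= H]; move: H; rewrite /inLambda /wt /=; lia. Qed.

Lemma wt_le (n : nat) (l : Lambda n) : (0 < n)%N -> wt l <= 4 * n%:Z - 3.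
Proof. by case: l => [[c d] /= H]; move: H; rewrite /inLambda /wt /=; lia. Qed.

(** * Coordinate functionals of a basis *)

(** Equality in A is decidable and coefficient families form a choice type, so
the unique expansion of each element can be picked as a function; uniqueness
makes it linear. *)
Lemma basis_coordinates (n : nat) (A : comAlgType {poly rat})
    (f : Lambda n -> A) : is_basis f ->
  exists co : Lambda n -> {scalar A}, forall l m, co l (f m) = (m == l)%:R.
Proof.
move=> fB.
have exc x : exists c : {ffun Lambda n -> {poly rat}},
    x == \sum_(l : Lambda n) c l *: f l.
  by have [c [/eqP xc _]] := fB x; exists c.
pose c x := xchoose (exc x).
have cE x : x = \sum_l c x l *: f l by apply/eqP/(xchooseP (exc x)).
have c_uniq x (g : Lambda n -> {poly rat}) :
    x = \sum_l g l *: f l -> c x =1 g.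
  move=> xg l; have [d [_ dU]] := fB x.
  rewrite -(dU _ (cE x)) (dU (finfun g)) ?ffunE //.
  by rewrite [LHS]xg; apply: eq_bigr => k _; rewrite ffunE.
have c_lin l : scalar (fun x => c x l).
  move=> p x y.
  apply: (c_uniq _ (fun l => p * c x l + c y l)).
  rewrite {1}(cE x) {1}(cE y) scaler_sumr -big_split /=.
  by apply: eq_bigr => k _; rewrite scalerDl scalerA.
pose co l : {scalar A} :=
  HB.pack (fun x => c x l) (GRing.isLinear.Build _ _ _ _ _ (c_lin l)).
exists co => l m; apply: (c_uniq _ (fun l => (m == l)%:R)).
rewrite (bigD1 m) //= eqxx scale1r big1 ?addr0 // => k.
by rewrite eq_sym => /negbTE ->; rewrite scale0r.
Qed.

(** * Coordinates in a quantum deformation *)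

Section Deformation.

Variables (n : nat) (n_ge3 : (3 <= n)%N) (A : comAlgType {poly rat}).
Variables (tau : Lambda n -> A) (tauQH : is_QH_IG tau).
Variables (a : Lambda n -> Lambda n -> rat) (sigma : Lambda n -> A).
Hypothesis def_sigma : quantum_deformation tau a sigma.

Local Notation N := (2 * n%:Z).
Local Notation T := (at_ tau).

Let n_gt0 : (0 < n)%N. Proof. by lia. Qed.

(** Since 4n exceeds every degree, only the first power of q occurs. *)
Lemma deg_q_power (l m : Lambda n) (j : nat) :
  (0 < j)%N -> wt m + N * j%:Z == wt l -> N <= wt l /\ j = 1.
Proof.
move=> j_gt0 /eqP deg.
have m_ge0 := wt_ge0 m n_gt0; have l_le := wt_le l n_gt0.
have [j1 | j_ge2] : (j = 1)%N \/ (2 <= j)%N by lia.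
  by rewrite j1 in deg *; split; first lia.
have := leq_mul (leqnn (2 * n)%N) j_ge2; lia.
Qed.

(** The constants that occur in the deformation: those compatible with the
grading for j = 1. *)
Definition defect (m k : Lambda n) : rat :=
  if wt k + N == wt m then a m k else 0.

Definition defect_at (p r : int * int) : rat :=
  at_ (fun m => at_ (defect m) r) p.

Lemma defect_atE (m : Lambda n) r : defect_at (part m) r = at_ (defect m) r.
Proof. exact: at_part. Qed.

Lemma defect_at_neq0 p r : defect_at p r != 0 ->
  [/\ inLambda n p, inLambda n r & r.1 + r.2 + N = p.1 + p.2].
Proof.
have [pL | npL] := boolP (inLambda n p); last first.
  by rewrite /defect_at at_notin ?eqxx.
rewrite (defect_atE (MkLambda pL)).
have [rL | nrL] := boolP (inLambda n r); last by rewrite at_notin ?eqxx.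
rewrite (at_part (defect _) (MkLambda rL)) /defect.
by case: ifP => [/eqP deg _|_ /eqP].
Qed.

Lemma sigma_low (l : Lambda n) : wt l < N -> sigma l = tau l.
Proof.
move=> low; rewrite [RHS]def_sigma big_nat_cond big1 ?addr0 // => j.
rewrite andbT => /andP[j_gt0 _]; rewrite big_pred0 // => m.
by apply/negP => /(deg_q_power j_gt0)[]; lia.
Qed.

(** Only the summand j = 1 survives; its terms sigma_m have degree at most
2n - 3, so they equal tau_m. *)
Lemma sigmaE (l : Lambda n) :
  sigma l = tau l - 'X *: \sum_(m : Lambda n) (defect l m)%:P *: tau m.
Proof.
have l_ge0 := wt_ge0 l n_gt0; have l_le := wt_le l n_gt0.
apply/eqP; rewrite eq_sym subr_eq; apply/eqP; rewrite [LHS]def_sigma.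
congr (_ + _); rewrite scaler_sumr.
have [l_lt | l_ge] := ltP (wt l) N.
  have ml (m : Lambda n) : (wt m + N == wt l) = false.
    by apply/eqP; have := wt_ge0 m n_gt0; lia.
  rewrite [RHS]big1 => [|m _]; last by rewrite /defect ml scale0r scaler0.
  rewrite big_nat_cond big1 // => j.
  rewrite andbT => /andP[j_gt0 _]; rewrite big_pred0 // => m.
  by apply/negP => /(deg_q_power j_gt0)[]; lia.
rewrite big_ltn; last by lia.
rewrite [X in _ + X]big_nat_cond [X in _ + X]big1 ?addr0; last first.
  move=> j; rewrite andbT => /andP[j_gt1 _]; rewrite big_pred0 // => m.
  by apply/negP => /(deg_q_power (ltnW j_gt1))[]; lia.
rewrite big_mkcond /=; apply: eq_bigr => m _.
rewrite /defect mulr1; case: eqP => [ml|_]; last by rewrite scale0r scaler0.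
by rewrite scalerA expr1 mulrC sigma_low //; lia.
Qed.

Variable co : Lambda n -> {scalar A}.
Hypothesis coE : forall l m, co l (tau m) = (m == l)%:R.

Lemma co_at l p : co l (T p) = (part l == p)%:R.
Proof.
have [pL | npL] := boolP (inLambda n p).
  by rewrite (at_part tau (MkLambda pL)) coE eq_sym.
rewrite at_notin // linear0; case: eqP => // lp.
by move: npL; rewrite -lp partP.
Qed.

(** The coordinate functionals of the deformed family: since sigma = (1 - qe) tau
and e has square zero for degree reasons, the dual family is transformed by
1 + qe. *)
Definition dco (l : Lambda n) (x : A) : {poly rat} :=
  co l x + 'X * \sum_(m : Lambda n) (defect m l)%:P * co m x.

Lemma dco_scalar l : scalar (dco l).
Proof.
move=> p x y; rewrite /dco linearP /= mulrDr addrACA; congr (_ + _).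
rewrite mulrCA -mulrDr; congr (_ * _); rewrite mulr_sumr -big_split /=.
by apply: eq_bigr => k _; rewrite linearP /=; ring.
Qed.

HB.instance Definition _ l :=
  GRing.isLinear.Build _ _ _ _ (dco l) (dco_scalar l).

Lemma dco_tau l m :
  dco l (tau m) = (m == l)%:R + 'X * (defect m l)%:P.
Proof.
rewrite /dco coE; congr (_ + 'X * _).
rewrite (bigD1 m) //= coE eqxx mulr1 big1 ?addr0 // => k km.
by rewrite coE eq_sym (negbTE km) mulr0.
Qed.

Lemma dco_sigma l m : dco l (sigma m) = (m == l)%:R.
Proof.
rewrite sigmaE linearB linearZ linear_sum /= dco_tau.
under eq_bigr => k _ do rewrite linearZ /= dco_tau mulrDr mulrCA.
rewrite big_split /= -mulr_sumr [X in 'X * (_ + 'X * X)]big1 => [|k _].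
  rewrite mulr0 addr0 (bigD1 l) //= eqxx mulr1 big1 ?addr0 ?addrK // => k kl.
  by rewrite (negbTE kl) mulr0.
(* two successive defects would drop the degree by 4n *)
rewrite /defect; case: eqP => [km|_]; last by rewrite mul0r.
case: eqP => [lk|_]; last by rewrite mulr0.
by have := wt_ge0 l n_gt0; have := wt_le m n_gt0; lia.
Qed.

Lemma dco_ge0 l x d : nonneg_expansion sigma x -> 0 <= (dco l x)`_d.
Proof.
case=> c [-> c_ge0]; rewrite linear_sum (bigD1 l) //=.
rewrite linearZ /= dco_sigma eqxx mulr1 big1 ?addr0 // => k kl.
by rewrite linearZ /= dco_sigma (negbTE kl) mulr0.
Qed.

Lemma dco_coef0 l x : (dco l x)`_0 = (co l x)`_0.
Proof. by rewrite coefD coefXM addr0. Qed.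

Lemma dco_coef1X l x : (dco l ('X *: x))`_1 = (co l x)`_0.
Proof. by rewrite linearZ /= coefXM dco_coef0. Qed.

Lemma dco_coef1_at l p : (dco l (T p))`_1 = defect_at p (part l).
Proof.
have [pL | npL] := boolP (inLambda n p).
  rewrite (at_part tau (MkLambda pL)) dco_tau (defect_atE (MkLambda pL)).
  rewrite at_part coefD coefXM coefC /= -polyC1.
  by case: (_ == l); rewrite ?coefC ?coef0 add0r.
by rewrite at_notin // linear0 coef0 /defect_at at_notin.
Qed.

(** * The positivity inequalities *)

Hypothesis sigma_pos : forall m : Lambda n,
  nonneg_expansion sigma (at_ sigma (1, 1) * sigma m).

Let sigma11 : at_ sigma (1, 1) = T (1, 1).
Proof.
have L11 : inLambda n (1, 1) by rewrite /inLambda /=; lia.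
rewrite (at_part sigma (MkLambda L11)) (at_part tau (MkLambda L11)).
by apply: sigma_low; rewrite /wt /=; lia.
Qed.

(** The coefficient of q in the coordinate of sigma_(1,1) * sigma_m along
sigma_l is the difference of the two sides. *)
Lemma deformed_pieri_ge0 (m l : Lambda n) :
  \sum_k defect m k * (co l (T (1, 1) * tau k))`_0
    <= (dco l (T (1, 1) * tau m))`_1.
Proof.
have := dco_ge0 l 1 (sigma_pos m).
rewrite sigma11 sigmaE mulrBr -scalerAr linearB coefB /= dco_coef1X subr_ge0.
congr (_ <= _); rewrite mulr_sumr linear_sum coef_sum.
by apply: eq_bigr => k _; rewrite -scalerAr linearZ /= coefCM.
Qed.

(** If |m| <= 4n-5, the classes k in the defect of m have degree at most 2n-5,
where multiplication by tau_(1,1) is the shift by (1,1). *)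
Lemma defect_sum_low (m l : Lambda n) : wt m <= 2 * N - 5 ->
  \sum_k defect m k * (co l (T (1, 1) * tau k))`_0
    = defect_at (part m) (l.1 - 1, l.2 - 1).
Proof.
move=> m_le; rewrite defect_atE -(sum_at (defect m)); apply: eq_bigr => k _.
rewrite /defect; case: eqP => [km|_]; last by rewrite !mul0r.
congr (_ * _); rewrite -(at_part tau k).
case: l k km => [[c d] Hl] [[x y] Hk]; rewrite /wt /= => km.
rewrite (QH_pieri11_generic tauQH) ?co_at /=; try by move: Hk km m_le;
  rewrite /inLambda /wt /=; lia.
rewrite -polyC_natr coefC /=; congr ((nat_of_bool _)%:R).
by apply/idP/idP => /eqP[-> ->]; apply/eqP; congr pair; lia.
Qed.

(** If |m| is 4n-4 or 4n-3, the classes k in the defect of m have degree 2n-4 or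
2n-3, where the Pieri rule has two terms. *)
Lemma defect_sum_high (m l : Lambda n) : 2 * N - 4 <= wt m ->
  \sum_k defect m k * (co l (T (1, 1) * tau k))`_0
    = defect_at (part m) (l.1 - 2, l.2) + defect_at (part m) (l.1 - 1, l.2 - 1).
Proof.
move=> m_ge; have m_le := wt_le m n_gt0.
rewrite !defect_atE -!(sum_at (defect m)) -big_split /=; apply: eq_bigr => k _.
rewrite /defect; case: eqP => [km|_]; last by rewrite !mul0r addr0.
rewrite -mulrDr; congr (_ * _); rewrite -(at_part tau k).
case: l k km => [[c d] Hl] [[x y] Hk]; rewrite /wt /= => km.
rewrite (QH_pieri11_middle tauQH) //; last first.
  by move: km m_ge m_le; rewrite /wt /=; lia.
rewrite linearD /= !co_at coefD /= -!polyC_natr !coefC /=.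
by congr ((nat_of_bool _)%:R + (nat_of_bool _)%:R); apply/idP/idP => /eqP[-> ->]; apply/eqP; congr pair; lia.
Qed.

Lemma defect_shift x y c d :
  inLambda n (x, y) -> N - 2 <= x + y -> x != N - 1 -> inLambda n (c, d) ->
  defect_at (x, y) (c - 1, d - 1) <= defect_at (x + 1, y + 1) (c, d).
Proof.
move=> pL xy_ge x_neq rL.
have := deformed_pieri_ge0 (MkLambda pL) (MkLambda rL).
rewrite defect_sum_low /=; last by move: pL x_neq; rewrite /inLambda /wt /=; lia.
rewrite -(at_part tau (MkLambda pL)) (QH_pieri11_generic tauQH) //=; try by lia.
by rewrite dco_coef1_at.
Qed.

(** The index (x, y) is reached from degree 2n-2 or 2n-1, where the defect
vanishes, by repeated shifts by (1,1). *)
Lemma defect_ge0 p r : 0 <= defect_at p r.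
Proof.
case: p r => x y [c d].
have [k kE] : exists k : nat, y < k%:Z by exists (absz y).+1; lia.
elim: k x y c d kE => [|k IH] x y c d yk;
  (have [-> //|/defect_at_neq0[pL rL /= deg]] :=
    eqVneq (defect_at (x, y) (c, d)) 0);
  first by move: pL rL deg yk; rewrite /inLambda /=; lia.
apply: le_trans (IH (x - 1) (y - 1) (c - 1) (d - 1) _) _; first by lia.
rewrite -[in leRHS](subrK 1 x) -[in leRHS](subrK 1 y).
by apply: defect_shift; rewrite //; move: pL rL deg; rewrite /inLambda /=; lia.
Qed.

(** For d >= 1 the class (c, d) does not occur in the product of tau_(1,1) with
a boundary class, which involves only second indices 0 and -1. *)
Lemma boundary_coef b c d (pL : inLambda n (N - 1, b))
    (rL : inLambda n (c, d)) : 1 <= d ->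
  (dco (MkLambda rL) (T (1, 1) * tau (MkLambda pL)))`_1 = 0.
Proof.
move=> d_ge1; rewrite -(at_part tau (MkLambda pL)) /=.
have co0 x y : y <= 0 -> (co (MkLambda rL) (T (x, y)))`_0 = 0.
  move=> y_le0; rewrite co_at /=; case: eqP => [[_ dy]|_]; last by rewrite coef0.
  by lia.
have [bE | b_neq] := eqVneq b (N - 3).
  rewrite [in T (_, b)]bE (QH_pieri11_line tauQH).
  by rewrite dco_coef1X linearD coefD /= !co0 ?addr0.
by rewrite (QH_pieri11_quantum tauQH) // dco_coef1X co0.
Qed.

Lemma boundary_low b c d : inLambda n (N - 1, b) -> b <= N - 4 ->
  inLambda n (c + 1, d + 1) -> 0 <= d -> defect_at (N - 1, b) (c, d) <= 0.
Proof.
move=> pL b_le rL d_ge0.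
have := deformed_pieri_ge0 (MkLambda pL) (MkLambda rL).
rewrite boundary_coef ?defect_sum_low /= ?addrK //; first by rewrite /wt /=; lia.
by lia.
Qed.

Lemma boundary_high b c d : inLambda n (N - 1, b) -> N - 3 <= b ->
  inLambda n (c, d) -> 1 <= d ->
  defect_at (N - 1, b) (c - 2, d) + defect_at (N - 1, b) (c - 1, d - 1) <= 0.
Proof.
move=> pL b_ge rL d_ge1.
have := deformed_pieri_ge0 (MkLambda pL) (MkLambda rL).
by rewrite boundary_coef ?defect_sum_high //= /wt /=; lia.
Qed.

Lemma defect_boundary b r : defect_at (N - 1, b) r = 0.
Proof.
case: r => c d; apply/eqP.
have [_ //|/[dup] neq0 /defect_at_neq0[pL rL /= deg]] :=
  eqVneq (defect_at (N - 1, b) (c, d)) 0.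
rewrite -(negbTE neq0) eq_le defect_ge0 andbT.
have [b_le | b_gt] := leP b (N - 4).
  by apply: boundary_low => //; move: pL rL deg; rewrite /inLambda /=; lia.
have b_ge : N - 3 <= b by lia.
have [d_ge1 | d_lt1] := leP 1 d.
  have rL2 : inLambda n (c + 2, d).
    by move: pL rL deg; rewrite /inLambda /=; lia.
  have := boundary_high pL b_ge rL2 d_ge1; rewrite addrK.
  by apply: le_trans; rewrite lerDl defect_ge0.
(* here d = 0 and c = b - 1 >= 2n-4, so (c, 1) is a partition because n >= 3 *)
have dE : d = 0 by move: pL rL deg; rewrite /inLambda /=; lia.
have rL2 : inLambda n (c + 1, 1).
  by move: pL rL deg; rewrite /inLambda /=; lia.
have := boundary_high pL b_ge rL2 isT; rewrite dE addrK subrr.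
by apply: le_trans; rewrite lerDr defect_ge0.
Qed.

Lemma defect_eq0 p r : defect_at p r = 0.
Proof.
case: p r => x y [c d].
have [k kE] : exists k : nat, N - 1 - x < k%:Z
  by exists (absz (N - 1 - x)%R).+1; lia.
elim: k x y c d kE => [|k IH] x y c d xk; apply/eqP;
  (have [_ //|/[dup] neq0 /defect_at_neq0[pL rL /= deg]] :=
    eqVneq (defect_at (x, y) (c, d)) 0);
  first by move: pL xk; rewrite /inLambda /=; lia.
rewrite -(negbTE neq0) eq_le defect_ge0 andbT.
have [-> | x_neq] := eqVneq x (N - 1); first by rewrite defect_boundary.
rewrite -(IH (x + 1) (y + 1) (c + 1) (d + 1)); last by lia.
rewrite -[in leLHS](addrK 1 c) -[in leLHS](addrK 1 d).
by apply: defect_shift; rewrite //; move: pL rL deg; rewrite /inLambda /=; lia.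
Qed.

Lemma deformation_trivial (l : Lambda n) : tau l = sigma l.
Proof.
rewrite sigmaE big1 ?scaler0 ?subr0 // => m _.
by rewrite -(at_part (defect l)) -defect_atE defect_eq0 scale0r.
Qed.

End Deformation.

Theorem theorem1p4 (n : nat) (hn : (3 <= n)%N)
    (A : comAlgType {poly rat}) (tau : Lambda n -> A) (hQH : is_QH_IG tau)
    (a : Lambda n -> Lambda n -> rat) (sigma : Lambda n -> A)
    (hdef : quantum_deformation tau a sigma)
    (hpos : forall mu : Lambda n,
       nonneg_expansion sigma (at_ sigma (1, 1) * sigma mu)) :
  forall l : Lambda n, tau l = sigma l.
Proof.
have [co coE] := basis_coordinates (QH_basis hQH).
exact: (deformation_trivial hn hQH hdef coE hpos).
Qed.
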